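(* Let $\Omega\subset\mathbb{R}^n$, $f$, $f^*$ be as in the context, let $\omega\in(0,1]$, let $\{D^{(k)}\}_{k\in\mathbb{N}_0}$ be a model-based sequence with thresholds $u^{(k)}$ (as defined in the context), and suppose $f$ is not a constant. If there exists $0<q<\infty$ such that, for all $k\in\mathbb{N}_0$, $$u^{(k)}-f^*\le\frac{1}{1+q}\max_{x\in D^{(k)}}[f(x)-f^*],$$ and $\omega\in(0,1]$ satisfies $0<\omega<q$, then for all $k\in\mathbb{N}_0$, $$\max_{x\in D^{(k+1)}}[f(x)-f^*]\le\frac{1+\omega}{1+q}\max_{x\in D^{(k)}}[f(x)-f^*],$$ where $\frac{1+\omega}{1+q}<1$.
   Context: Setting: $\Omega\subset\mathbb{R}^n$ is a (not necessarily convex) closed domain with $\max_{x,y\in\Omega}\|x-y\|_2\le 1$; $f:\Omega\to\mathbb{R}$ is continuous; $f^*=\min_{x\in\Omega}f(x)$. Quasi-uniformity: a finite set $\chi=\{\chi_i\}_{i=1}^N\subset D$ is quasi-uniform over $D$ with uniformity constant $\tau>0$ if $\frac1\tau q_\chi\le h_{D,\chi}\le\tau q_\chi$, where $h_{D,\chi}=\sup_{x\in D}\min_{i}\|x-\chi_i\|_2$ and $q_\chi=\frac12\min_{\chi_i\ne\chi_j}\|\chi_i-\chi_j\|_2$. Model-based sequence: for $\omega\in(0,1]$, $\{D^{(k)}\}$ is defined recursively by $D^{(0)}=\Omega$ and $$D^{(k+1)}=\{x\in D^{(k)}:\mathcal{A}^{(k)}f(x)\le u^{(k)}\},$$ where $\chi^{(k)}=\{\chi^{(k)}_i\}$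 is a finite set of $N^{(k)}$ points quasi-uniformly distributed over $D^{(k)}$ with $\chi^{(k)}\cap\chi^{(k+1)}=\chi^{(k)}\cap D^{(k+1)}$; $f^*_{\chi^{(k)}}=\min_i f(\chi^{(k)}_i)$ and $f^{**}_{\chi^{(k)}}=\max_i f(\chi^{(k)}_i)$; $u^{(k)}$ is any number in $[f^*_{\chi^{(k)}},f^{**}_{\chi^{(k)}}]$; and $\mathcal{A}^{(k)}f:D^{(k)}\to\mathbb{R}$ is a continuous approximation of $f$ built from the data $(\chi^{(k)},f|_{\chi^{(k)}})$ satisfying the error bound condition $$\max_{x\in D^{(k)}}|\mathcal{A}^{(k)}f(x)-f(x)|\le\omega\,(u^{(k)}-f^*_{\chi^{(k)}}).$$ *)

(* Defs.v *)
From mathcomp Require Import all_boot all_order all_algebra.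
From mathcomp Require Import all_classical all_reals all_analysis.

Set Implicit Arguments.
Unset Strict Implicit.
Unset Printing Implicit Defensive.

Import Order.TTheory GRing.Theory Num.Theory.
Import numFieldNormedType.Exports.

Local Open Scope classical_set_scope.
Local Open Scope ring_scope.

(* The library norm on 'rV[R]_n is the sup norm; it induces the same topology
   as the Euclidean norm. *)
Definition norm2 (R : realType) (n : nat) (x : 'rV[R]_n) : R :=
  Num.sqrt (\sum_(i < n) x 0 i ^+ 2).

(* Only meaningful when the extremum is attained; see max_on_attained. *)
Definition max_on (R : realType) (T : Type) (D : set T) (g : T -> R) : R :=
  sup (g @` D).

Definition min_on (R : realType) (T : Type) (D : set T) (g : T -> R) : R :=
  inf (g @` D).

Lemma max_on_attained (R : realType) (n : nat) (D : set 'rV[R]_n)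
    (g : 'rV[R]_n -> R) :
  D !=set0 -> compact D -> {within D, continuous g} ->
  exists2 x, D x & max_on D g = g x /\ (forall y, D y -> g y <= g x).
Proof.
move=> D0 Dc gc; have [x /set_mem Dx gx] := EVT_max_rV D0 Dc gc.
have ub : ubound (g @` D) (g x) by move=> _ [y Dy <-]; apply/gx/mem_set.
exists x => //; split; last by move=> y Dy; apply: ub; exists y.
apply/eqP; rewrite eq_le ge_sup//=; last by exists (g x), x.
by apply: ub_le_sup; [exists (g x)|exists x].
Qed.

Lemma min_on_attained (R : realType) (n : nat) (D : set 'rV[R]_n)
    (g : 'rV[R]_n -> R) :
  D !=set0 -> compact D -> {within D, continuous g} ->
  exists2 x, D x & min_on D g = g x /\ (forall y, D y -> g x <= g y).
Proof.
move=> D0 Dc gc; have [x /set_mem Dx gx] := EVT_min_rV D0 Dc gc.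
have lb : lbound (g @` D) (g x) by move=> _ [y Dy <-]; apply/gx/mem_set.
exists x => //; split; last by move=> y Dy; apply: lb; exists y.
apply/eqP; rewrite eq_le lb_le_inf//= ?andbT; last by exists (g x), x.
by apply: ge_inf; [exists (g x)|exists x].
Qed.

Section QuasiUniform.
Variables (R : realType) (n : nat).
Implicit Types D chi : set 'rV[R]_n.

Definition fill_distance D chi : R :=
  sup [set min_on chi (fun c => norm2 (x - c)) | x in D].

(* For a one-point set the infimum ranges over the empty set and is 0 by
   convention; such a set is then quasi-uniform over D only when D is that
   very point. *)
Definition separation_radius chi : R :=
  2^-1 * inf [set d | exists x y, [/\ chi x, chi y, x != y & d = norm2 (x - y)]].

Definition quasi_uniform_const (tau : R) D chi : Prop :=
  [/\ finite_set chi, chi !=set0, chi `<=` D &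
      tau^-1 * separation_radius chi <= fill_distance D chi
        <= tau * separation_radius chi].

Definition quasi_uniform D chi : Prop :=
  exists2 tau : R, 0 < tau & quasi_uniform_const tau D chi.

End QuasiUniform.

(* Functions on a subset of R^n are represented by total functions, of which
   only the values on that subset matter.  [A k] is the approximation operator
   at step k, so that [A k f] is the approximation of f; [mbs_data] says that
   it is built from the values on the sample set only. *)
Record model_based_sequence (R : realType) (n : nat) (Omega : set 'rV[R]_n)
    (f : 'rV[R]_n -> R) (omega : R) (D chi : nat -> set 'rV[R]_n)
    (u : nat -> R) (A : nat -> ('rV[R]_n -> R) -> 'rV[R]_n -> R) : Prop := {
  mbs_init : D 0%N = Omega;
  mbs_step : forall k, D k.+1 = [set x | D k x /\ A k f x <= u k];
  mbs_quasi_uniform : forall k, quasi_uniform (D k) (chi k);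
  mbs_reuse : forall k, chi k `&` chi k.+1 = chi k `&` D k.+1;
  mbs_threshold : forall k, min_on (chi k) f <= u k <= max_on (chi k) f;
  mbs_data : forall k g h, (forall x, chi k x -> g x = h x) ->
    forall x, D k x -> A k g x = A k h x;
  mbs_continuous : forall k, {within D k, continuous (A k f)};
  mbs_error_bound : forall k,
    max_on (D k) (fun x => `|A k f x - f x|)
      <= omega * (u k - min_on (chi k) f)
}.

(* Main.v *)
Require Import Defs.
From mathcomp Require Import all_boot all_order all_algebra.
From mathcomp Require Import all_classical all_reals all_analysis.
From mathcomp Require Import lra.

Set Implicit Arguments.
Unset Strict Implicit.
Unset Printing Implicit Defensive.

Import Order.TTheory GRing.Theory Num.Theory.
Import numFieldNormedType.Exports.

Local Open Scope classical_set_scope.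
Local Open Scope ring_scope.

(* On D^(k+1) the approximation is at most u^(k), so
   f <= A^(k) f + |A^(k) f - f| <= u^(k) + omega (u^(k) - f*_chi), and f* <= f*_chi
   gives f - f* <= (1 + omega) (u^(k) - f* ); the hypothesis on u^(k) bounds the
   last factor.  Compactness of each D^(k) ensures that the pointwise error is
   bounded by its supremum. *)

(** The square of each coordinate is one term of a sum of nonnegative terms. This turns a Euclidean
    diameter bound into boundedness for the sup norm. *)
Lemma mx_norm_le_norm2 (R : realType) (n : nat) (x : 'rV[R]_n) :
  `|x| <= norm2 x.
Proof.
rewrite /Num.norm /= mx_normrE; apply: bigmax_le => [|[i j] _ /=].
  exact: sqrtr_ge0.
rewrite ord1 -sqrtr_sqr; apply: ler_wsqrtr.
by rewrite (bigD1 j) //= lerDl; apply: sumr_ge0 => l _; exact: sqr_ge0.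
Qed.

Lemma closed_diam_compact (R : realType) (n : nat) (B : set 'rV[R]_n) (d : R) :
  closed B -> (forall x y, B x -> B y -> norm2 (x - y) <= d) -> compact B.
Proof.
move=> Bcl Bd; have [->|/set0P[a Ba]] := eqVneq B set0; first exact: compact0.
apply: bounded_closed_compact Bcl.
(* Every [y] in [B] is [a + (y - a)], of norm at most [|a| + d]; with closedness, Heine-Borel
   applies. *)
exists (`|a| + d); split; first exact: num_real.
move=> M ltM y By; apply: le_trans (ltW ltM).
rewrite -(subrK a y) addrC (le_trans (ler_normD _ _)) // lerD2l.
exact: le_trans (mx_norm_le_norm2 _) (Bd _ _ By Ba).
Qed.

Lemma compact_sublevel (R : realType) (T : topologicalType) (B : set T)
    (g : T -> R) (c : R) :
  compact B -> {within B, continuous g} ->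
  compact [set x | B x /\ g x <= c].
Proof.
(* As [g] is continuous only within [B], the sublevel set is closed relative to [B]: it is the trace
   on [B] of a closed set [V]. *)
move=> Bc /continuous_closedP/(_ _ (@closed_le _ c))/closed_subspaceP[V Vcl VB].
have -> : [set x | B x /\ g x <= c] = B `&` V.
  by rewrite setIC VB; apply/seteqP; split=> x /= [].
exact: compact_closedI.
Qed.

Section ModelBasedSequence.
Variables (R : realType) (n : nat) (Omega : set 'rV[R]_n).
Variables (f : 'rV[R]_n -> R) (omega : R) (D chi : nat -> set 'rV[R]_n).
Variables (u : nat -> R) (A : nat -> ('rV[R]_n -> R) -> 'rV[R]_n -> R).
Hypothesis mbs : model_based_sequence Omega f omega D chi u A.

Lemma mbs_sub k : D k `<=` Omega.
Proof.
elim: k => [|k IH x]; first by rewrite (mbs_init mbs).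
by rewrite (mbs_step mbs) => -[/IH].
Qed.

Lemma mbs_sample_neq0 k : chi k !=set0.
Proof. by have [tau _ []] := mbs_quasi_uniform mbs k. Qed.

Lemma mbs_sample_sub k : chi k `<=` D k.
Proof. by have [tau _ []] := mbs_quasi_uniform mbs k. Qed.

Lemma mbs_neq0 k : D k !=set0.
Proof.
by have [c chic] := mbs_sample_neq0 k; exists c; exact: (@mbs_sample_sub k).
Qed.

Hypothesis Omega_compact : compact Omega.
Hypothesis f_cont : {within Omega, continuous f}.

Lemma mbs_compact k : compact (D k).
Proof.
elim: k => [|k IH]; first by rewrite (mbs_init mbs).
by rewrite (mbs_step mbs); exact: (compact_sublevel IH (mbs_continuous mbs (k:=k))).
Qed.

Lemma mbs_min_sample_ge k : min_on Omega f <= min_on (chi k) f.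
Proof.
have [c chic] := mbs_sample_neq0 k.
have OD x : chi k x -> Omega x by move=> /(@mbs_sample_sub k)/(@mbs_sub k).
have [x _ [-> fx]] : exists2 x, Omega x &
    min_on Omega f = f x /\ (forall y, Omega y -> f x <= f y).
  by apply: min_on_attained => //; exists c; exact: OD.
apply: lb_le_inf; first by exists (f c), c.
by move=> _ [y /OD Oy <-]; exact: fx.
Qed.

(** A [sup] dominates the values only when they are bounded above. Here the error is continuous on
    the compact nonempty [D k], so its supremum is an attained maximum. *)
Lemma mbs_pointwise_error k x : D k x ->
  `|A k f x - f x| <= omega * (u k - min_on (chi k) f).
Proof.
move=> Dx; apply: le_trans (mbs_error_bound mbs k).
have [y Dy [-> le_y]] : exists2 y, D k y &
    max_on (D k) (fun z => `|A k f z - f z|) = `|A k f y - f y| /\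
    (forall z, D k z -> `|A k f z - f z| <= `|A k f y - f y|).
  apply: (max_on_attained (mbs_neq0 k) (@mbs_compact k)).
  apply: (@within_continuous_comp _ _ _ _ (A k f - f) Num.norm).
    by move=> z _; exact: norm_continuous.
  apply: within_continuousB; first exact: (mbs_continuous mbs (k:=k)).
  exact: continuous_subspaceW (@mbs_sub k) f_cont.
exact: le_y.
Qed.

Lemma mbs_step_gap_le k x : 0 <= omega -> D k.+1 x ->
  f x - min_on Omega f <= (1 + omega) * (u k - min_on Omega f).
Proof.
move=> omega_ge0; rewrite (mbs_step mbs) => -[Dx Aux].
have := mbs_pointwise_error Dx; rewrite ler_norml => /andP[err _].
(* The sample minimum is at least the global one, and [omega] is nonnegative. *)
have gap : omega * (u k - min_on (chi k) f) <= omega * (u k - min_on Omega f).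
  by rewrite ler_wpM2l // lerD2l lerN2; exact: mbs_min_sample_ge.
(* Add [err], which bounds [f x - A k f x] from above, to [Aux] and [gap]. *)
lra.
Qed.

End ModelBasedSequence.

Theorem theorem2 (R : realType) (n : nat) (Omega : set 'rV[R]_n)
    (f : 'rV[R]_n -> R) (omega : R) (D chi : nat -> set 'rV[R]_n)
    (u : nat -> R) (A : nat -> ('rV[R]_n -> R) -> 'rV[R]_n -> R) (q : R)
    (Omega_nonempty : Omega !=set0)
    (Omega_closed : closed Omega)
    (Omega_diam : forall x y, Omega x -> Omega y -> norm2 (x - y) <= 1)
    (f_continuous : {within Omega, continuous f})
    (omega_range : 0 < omega <= 1)
    (seq_model : model_based_sequence Omega f omega D chi u A)
    (f_not_constant : ~ (exists c : R, forall x, Omega x -> f x = c))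
    (q_gt0 : 0 < q)
    (u_bound : forall k : nat,
      u k - min_on Omega f
        <= (1 + q)^-1 * max_on (D k) (fun x => f x - min_on Omega f))
    (omega_lt_q : omega < q) :
  (forall k : nat,
    max_on (D k.+1) (fun x => f x - min_on Omega f)
      <= (1 + omega) / (1 + q) * max_on (D k) (fun x => f x - min_on Omega f))
  /\ (1 + omega) / (1 + q) < 1.
Proof.
have q1_gt0 : 0 < 1 + q by lra.
split; last by rewrite ltr_pdivrMr // mul1r ltrD2l.
have /andP[/ltW omega_ge0 _] := omega_range.
have Oc := closed_diam_compact Omega_closed Omega_diam.
move=> k; have [c Dc] := mbs_neq0 seq_model k.+1.
(* Bounding a [sup] by an upper bound requires a nonempty set; the point [c] of [D k.+1] comes from
   its sample set. *)
apply: ge_sup => [|_ [x Dx <-]]; first by exists (f c - min_on Omega f), c.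
apply: le_trans (mbs_step_gap_le seq_model Oc f_continuous omega_ge0 Dx) _.
by rewrite -mulrA ler_wpM2l // addr_ge0.
Qed.
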